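(* Let $q$ be a prime power and let $f = f_1 f_2$, where $f_1, f_2 \in \mathbb{F}_q[x]$ are nonconstant polynomials with $\gcd(f_1,f_2) = 1$. Assume further that $\mathrm{rad}(f_1)$ and $\mathrm{rad}(f_2)$ have the same factorization type. Let $$D_1 = \mathrm{Div}(f_1), \qquad D_2 = \mathrm{Div}(f_2).$$ Then $G_f(D_1)$ and $G_f(D_2)$ are isomorphic. In fact, they are both isomorphic to the wreath product $G_{\mathrm{rad}(f_1)}(\{1\}) * E_m$, where $m = \dfrac{|f|}{|\mathrm{rad}(f_1)|}$.
   Context: For nonzero $h \in \mathbb{F}_q[x]$, $|h| = q^{\deg h}$; $\mathrm{rad}(h)$ is the product of all distinct monic irreducible factors of $h$; $\mathrm{Div}(h)$ is the set of divisors of $h$ up to multiplication by nonzero constants (equivalently, monic divisors). The factorization type of a monic polynomial $h$ of degree $n$ is the $n$-tuple $(a_1,\ldots,a_n)$ where $a_i$ is the number of distinct irreducible factors of $h$ of degree $i$. For nonconstant $f$ and $D \subset \mathrm{Div}(f)$ with $f \notin D$, the gcd-graph $G_f(D)$ is the simple undirected graph with vertex set $\mathbb{F}_q[x]/f$ in which $a,b$ are adjacent iff $\gcd(a-b,f) \in D$. In particular $G_h(\{1\})$ is the unitary Cayley graph of $\mathbb{F}_q[x]/h$. The wreath (lexicographic) product $\Gamma * \Delta$ of graphs has vertex set $V(\Gamma)\times V(\Delta)$, with $(x,y)$ and $(x',y')$ adjacent iff either $(x,x') \in E(\Gamma)$, or $x=x'$ and $(y,y') \in E(\Delta)$. $E_m$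 is the graph on $m$ vertices with no edges. *)

(* Defs.v *)
From HB Require Import structures.
From mathcomp Require Import all_boot all_order all_algebra.

Set Implicit Arguments.
Unset Strict Implicit.
Unset Printing Implicit Defensive.

Import GRing.Theory.
Local Open Scope ring_scope.

Record sgraph := SGraph {
  vertex :> finType;
  edge : rel vertex;
  edge_sym : symmetric edge;
  edge_irr : irreflexive edge
}.

Definition graph_iso (G H : sgraph) : Prop :=
  exists2 phi : G -> H, bijective phi &
    forall x y, edge (phi x) (phi y) = edge x y.

Section Wreath.
Variables G H : sgraph.

Definition wreath_edge : rel (G * H) := fun u v =>
  edge u.1 v.1 || (u.1 == v.1) && edge u.2 v.2.

Lemma wreath_edge_sym : symmetric wreath_edge.
Proof.
by move=> u v; rewrite /wreath_edge edge_sym eq_sym [edge u.2 _]edge_sym.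
Qed.

Lemma wreath_edge_irr : irreflexive wreath_edge.
Proof. by move=> u; rewrite /wreath_edge !edge_irr andbF. Qed.

Definition wreath : sgraph := SGraph wreath_edge_sym wreath_edge_irr.
End Wreath.

Section Edgeless.
Variable m : nat.

Definition no_edge : rel 'I_m := fun _ _ => false.

Lemma no_edge_sym : symmetric no_edge. Proof. by []. Qed.
Lemma no_edge_irr : irreflexive no_edge. Proof. by []. Qed.

Definition edgeless : sgraph := SGraph no_edge_sym no_edge_irr.
End Edgeless.

Section GcdGraph.
Variable F : finFieldType.
Implicit Types (f h : {poly F}) (D : {pred {poly F}}).

(* |h| = q ^ deg h, for h != 0 (size h is deg h + 1). *)
Definition pabs h : nat := (#|F| ^ (size h).-1)%N.

Definition monicize h : {poly F} := (lead_coef h)^-1 *: h.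

Lemma monicize_eqp h k : h %= k -> monicize h = monicize k.
Proof.
case: (eqVneq k 0) => [->|kN0 hk]; first by rewrite eqp0 => /eqP->.
have hN0 : h != 0 by apply: contraNneq kN0 => h0; move: hk; rewrite h0 eqp_sym eqp0.
have [lh lk] : lead_coef h != 0 /\ lead_coef k != 0 by rewrite !lead_coef_eq0.
apply: (scalerI lk); rewrite [RHS]scalerA divff // scale1r.
by rewrite scalerA mulrC -scalerA (eqp_eq hk) scalerA mulVf // scale1r.
Qed.

(* Divisors up to nonzero constants, represented by the monic ones. *)
Definition Div h : {pred {poly F}} := [pred d | (d \is monic) && (d %| h)].

(* For h != 0 every factor of h has size at most size h, so bounding the size
   loses nothing and makes the set finite. *)
Definition irr_factors h : {set {poly_(size h) F}} :=
  [set p : {poly_(size h) F} |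
    [&& polyn p \is monic, irreducibleb (polyn p) & polyn p %| h]].

Definition radical h : {poly F} := \prod_(p in irr_factors h) polyn p.

(* The entry at position i counts the factors of degree i + 1; the length of
   the sequence is deg h. *)
Definition fact_type h : seq nat :=
  [seq #|[set p in irr_factors h | (size (polyn p)).-1 == i]|
     | i <- iota 1 (size h).-1].

(* {poly %/ p} is F[x]/(p) only for monic nonconstant p, hence monicize, which
   leaves the ideal (f) unchanged.  Classes are represented by their remainders;
   gcd(a - b, f) does not depend on the representatives.  It is normalized to be
   monic because gcdp is only defined up to a unit. *)
Definition gcd_adj f D : rel {poly %/ monicize f} := fun a b =>
  monicize (gcdp (polyn a - polyn b) f) \in D.

Definition gcd_edge f D : rel {poly %/ monicize f} := fun a b =>
  (a != b) && gcd_adj D a b.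

Lemma gcd_edge_sym f D : symmetric (@gcd_edge f D).
Proof.
move=> a b; rewrite /gcd_edge /gcd_adj eq_sym; congr (_ && (_ \in D)).
apply/monicize_eqp/eqp_gcdl.
by rewrite -opprB -scaleN1r eqp_scale // oppr_eq0 oner_eq0.
Qed.

Lemma gcd_edge_irr f D : irreflexive (@gcd_edge f D).
Proof. by move=> a; rewrite /gcd_edge eqxx. Qed.

Definition gcd_graph f D : sgraph :=
  SGraph (@gcd_edge_sym f D) (@gcd_edge_irr f D).

(* When f is not in D, the guard a != b is redundant. *)
Lemma gcd_graphE f D (a b : gcd_graph f D) :
  monicize f \notin D -> edge a b = gcd_adj D a b.
Proof.
move=> fND; rewrite /= /gcd_edge; case: eqVneq => //= ->.
by rewrite /gcd_adj subrr gcd0p (negPf fND).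
Qed.

End GcdGraph.

(* Main.v *)
(* Since f1 and f2 are coprime, gcd(d, f1 f2) divides f1 iff d is coprime to f2,
   that is, iff d is coprime to rad(f2).  Hence adjacency in G_f(Div f1) depends
   only on the classes modulo rad(f2), and every class modulo rad(f2) is the
   image of m = |f| / |rad(f2)| classes modulo f: this is the wreath product of
   G_rad(f2)({1}) with E_m.  By the Chinese remainder theorem, G_h({1}) for a
   squarefree h is the graph of tuples of residues modulo the irreducible factors
   p of h, two tuples being adjacent iff they differ in every coordinate.  It is
   therefore determined by the sizes q ^ deg p of the coordinate sets, so that
   rad(f1) and rad(f2), which have the same factorization type, give isomorphic
   graphs. *)
Require Import Defs.
From HB Require Import structures.
From mathcomp Require Import all_boot all_order all_algebra.
From mathcomp Require Import zify.

Set Implicit Arguments.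
Unset Strict Implicit.
Unset Printing Implicit Defensive.

Import GRing.Theory.
Local Open Scope ring_scope.

(** * Graph isomorphisms and wreath products *)

Lemma graph_iso_sym (G H : sgraph) : graph_iso G H -> graph_iso H G.
Proof.
move=> [phi [psi phiK psiK] phiE]; exists psi; first by exists phi.
by move=> x y; rewrite -phiE !psiK.
Qed.

Lemma graph_iso_trans (G H K : sgraph) :
  graph_iso G H -> graph_iso H K -> graph_iso G K.
Proof.
move=> [phi phi_bij phiE] [psi psi_bij psiE].
by exists (psi \o phi) => [|x y /=]; [exact: bij_comp | rewrite psiE].
Qed.

Lemma wreath_isol (G H K : sgraph) :
  graph_iso G H -> graph_iso (wreath G K) (wreath H K).
Proof.
move=> [phi [psi phiK psiK] phiE].
exists (fun u : G * K => (phi u.1, u.2)) => [|u v].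
  by exists (fun u : H * K => (psi u.1, u.2)) => -[x y] /=; rewrite ?phiK ?psiK.
by rewrite /edge /= /wreath_edge /= phiE (can_eq phiK).
Qed.

(** Here [c] projects to the base graph and [e] labels the points of a fibre. Joint injectivity and
    the cardinality of [G] make the pair a bijection, so fibres need not be counted one by one. *)
Lemma wreath_edgeless_iso (G H : sgraph) (T : finType) (c : G -> H)
    (e : G -> T) (m : nat) :
    #|T| = m -> injective (fun x => (c x, e x)) -> #|G| = (#|H| * m)%N ->
    (forall x y, edge x y = edge (c x) (c y)) ->
  graph_iso G (wreath H (edgeless m)).
Proof.
move=> <- ce_inj cardG cE.
exists (fun x => (c x, enum_rank (e x)) : wreath H (edgeless #|T|)).
  apply: inj_card_bij => [x y [cxy /enum_rank_inj exy]|].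
    by apply: ce_inj; rewrite cxy exy.
  by rewrite /= card_prod card_ord cardG.
by move=> x y; rewrite cE /edge /= /wreath_edge /= /no_edge andbF orbF.
Qed.

(** * Products of monic irreducible polynomials *)

Section PolyOverField.
Variable K : fieldType.
Implicit Types (p q d : {poly K}) (ps : seq {poly K}).

Lemma monic_eqp p q : p \is monic -> q \is monic -> p %= q -> p = q.
Proof. by move=> mp mq; rewrite eqp_monic // => /eqP. Qed.

Lemma coprimep_prod d ps :
  coprimep d (\prod_(p <- ps) p) = all (coprimep d) ps.
Proof.
elim: ps => [|p ps IH]; first by rewrite big_nil coprimep1.
by rewrite big_cons coprimepMr IH.
Qed.

Lemma irredp_monic_dvd p q : irreducible_poly p -> irreducible_poly q ->
  p \is monic -> q \is monic -> p %| q -> p = q.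
Proof.
move=> [sp _] [_ irr_q] mp mq /irr_q pq; apply: monic_eqp => //.
by apply: pq; rewrite neq_ltn sp orbT.
Qed.

Definition monic_irreds ps :=
  forall p, p \in ps -> p \is monic /\ irreducible_poly p.

Lemma monic_irreds_cons p ps : monic_irreds (p :: ps) -> monic_irreds ps.
Proof. by move=> H q qps; apply: H; rewrite inE qps orbT. Qed.

Lemma irredp_dvd_prod p ps : monic_irreds ps ->
  p \is monic -> irreducible_poly p -> p %| \prod_(q <- ps) q = (p \in ps).
Proof.
move=> irr_ps mp irr_p; apply/idP/idP => [|p_ps]; last first.
  by rewrite (big_rem p p_ps) /= dvdp_mulr.
apply: contraLR => pNps.
rewrite -irreducible_poly_coprime // coprimep_prod.
apply/allP => q qps; rewrite irreducible_poly_coprime //.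
have [mq irr_q] := irr_ps q qps.
by apply: contra pNps => /(irredp_monic_dvd irr_p irr_q mp mq) ->.
Qed.

(** Distinct monic irreducibles are coprime, so Gauss's lemma splits off one factor at a time. *)
Lemma dvdp_prod_irreds d ps : monic_irreds ps -> uniq ps ->
  \prod_(p <- ps) p %| d = all (fun p => p %| d) ps.
Proof.
elim: ps => [|p ps IH] irr_ps /=; first by rewrite big_nil dvd1p.
case/andP=> pNps uniq_ps; have irr_ps' := monic_irreds_cons irr_ps.
have [mp irr_p] := irr_ps p (mem_head _ _).
by rewrite big_cons Gauss_dvdp ?IH // irreducible_poly_coprime //
  irredp_dvd_prod.
Qed.

End PolyOverField.

(** * Irreducible factors and radicals over a finite field *)

Section FiniteField.
Variable F : finFieldType.
Implicit Types (f g h p q d r : {poly F}) (ps : seq {poly F}).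

Lemma irredp_factor h : (1 < size h)%N ->
  exists p, [/\ p \is monic, irreducible_poly p & p %| h].
Proof.
have [n] := ubnP (size h); elim: n h => // n IH h; rewrite ltnS => hn sh.
have h0 : h != 0 by rewrite -size_poly_gt0 ltnW.
have [irr_h|] := boolP (irreducibleb h); last first.
  (* Boolean irreducibility quantifies over polynomials of size at most [(size h).-1], so the
     witness [q] is a nonconstant divisor to which induction applies. *)
  rewrite /irreducibleb sh /= negb_forall => /existsP[q].
  rewrite negb_imply -dvdpE -ltnNge => /andP[qh sq].
  have [||p [mp irr_p pq]] := IH q => //.
    apply: leq_trans hn; apply: leq_ltn_trans (size_npoly q) _.
    by rewrite prednK // ltnW.
  by exists p; split=> //; apply: dvdp_trans qh.
have lh : (lead_coef h)^-1 != 0 by rewrite invr_eq0 lead_coef_eq0.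
exists ((lead_coef h)^-1 *: h); split.
- by rewrite monicE lead_coefZ mulVf // lead_coef_eq0.
- have [_ irr] := irreducibleP _ irr_h.
  split=> [|q sq]; first by rewrite size_scale.
  rewrite dvdpZr // => /(irr _ sq) qh.
  by apply: eqp_trans qh _; rewrite eqp_sym eqp_scale.
- by rewrite dvdpZl.
Qed.

(* Sorted by degree so that polynomials of the same factorization type have
   equal, not merely permuted, lists of degrees. *)
Definition irr_factor_seq h : seq {poly F} :=
  sort (relpre (fun p => (size p).-1) leq)
    [seq polyn u | u <- enum (irr_factors h)].

Lemma irr_factor_seq_uniq h : uniq (irr_factor_seq h).
Proof. by rewrite sort_uniq map_inj_uniq ?enum_uniq //; apply: val_inj. Qed.

Lemma mem_irr_factor_seq h p : h != 0 ->
  reflect [/\ p \is monic, irreducible_poly p & p %| h] (p \in irr_factor_seq h).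
Proof.
move=> h0; rewrite mem_sort; apply: (iffP mapP) => [[q]|[mp irr_p ph]].
  by rewrite mem_enum inE => /and3P[mq /irreducibleP irr_q qh] ->.
have sp : (size p <= size h)%N by rewrite dvdp_leq.
exists (NPoly sp) => //; rewrite mem_enum inE /= mp ph andbT.
exact/irreducibleP.
Qed.

Lemma irr_factor_seq_irreds h : monic_irreds (irr_factor_seq h).
Proof.
move=> p; rewrite mem_sort => /mapP[q].
by rewrite mem_enum inE => /and3P[mq /irreducibleP irr_q qh] ->.
Qed.

Lemma radicalE h : radical h = \prod_(p <- irr_factor_seq h) p.
Proof.
rewrite /radical -big_enum /= (perm_big _ (permEl (perm_sort _ _))) /=.
by rewrite big_map.
Qed.

Lemma radical_neq0 h : radical h != 0.
Proof.
rewrite radicalE prodf_seq_neq0; apply/allP => p /irr_factor_seq_irreds[_ irr_p].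
by rewrite irredp_neq0.
Qed.

Lemma radical_dvd h : h != 0 -> radical h %| h.
Proof.
move=> h0; rewrite radicalE dvdp_prod_irreds ?irr_factor_seq_uniq //; last first.
  exact: irr_factor_seq_irreds.
by apply/allP=> p /mem_irr_factor_seq[].
Qed.

Lemma size_radical_gt1 h : (1 < size h)%N -> (1 < size (radical h))%N.
Proof.
move=> sh; have h0 : h != 0 by rewrite -size_poly_gt0 ltnW.
have [p [mp irr_p ph]] := irredp_factor sh; have [sp _] := irr_p.
apply: leq_trans sp _; rewrite dvdp_leq ?radical_neq0 //.
rewrite radicalE irredp_dvd_prod //; first exact/mem_irr_factor_seq.
exact: irr_factor_seq_irreds.
Qed.

(** If [gcdp d h] is nonconstant, it has a monic irreducible factor, which is then one of the
    factors of the radical. *)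
Lemma coprimep_radical d h : h != 0 -> coprimep d (radical h) = coprimep d h.
Proof.
move=> h0; apply/idP/idP; last exact/coprimep_dvdl/radical_dvd.
rewrite radicalE coprimep_prod => /allP co_d.
apply: contraT => /negbTE dNh.
have gcd0 : gcdp d h != 0 by rewrite gcdp_eq0 (negPf h0) andbF.
have [|p [mp irr_p]] := @irredp_factor (gcdp d h).
  by rewrite ltn_neqAle size_poly_gt0 gcd0 andbT eq_sym; move/negbT: dNh.
rewrite dvdp_gcd => /andP[pd ph].
have /co_d : p \in irr_factor_seq h by apply/mem_irr_factor_seq.
by rewrite coprimep_sym irreducible_poly_coprime // pd.
Qed.

(** * Factorization types as lists of degrees *)

Lemma count_irr_factor_seq h i :
  count_mem i [seq (size p).-1 | p <- irr_factor_seq h] =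
  #|[set u in irr_factors h | (size (polyn u)).-1 == i]|.
Proof.
rewrite count_map (permP (permEl (perm_sort _ _))) count_map cardE.
rewrite -size_filter /=; congr size.
rewrite /enum_mem -filter_predI; apply: eq_filter => p.
by rewrite !inE /= andbC.
Qed.

Lemma irr_factor_seq_size h i : h != 0 ->
  i \in [seq (size p).-1 | p <- irr_factor_seq h] -> (0 < i <= (size h).-1)%N.
Proof.
move=> h0 /mapP[p /(mem_irr_factor_seq _ h0)[_ [sp _] ph] ->].
rewrite -ltnS prednK ?(ltnW sp) // sp /=.
by have := dvdp_leq h0 ph; case: (size p) (size h) => [|a] [].
Qed.

(** Equal types give every degree the same multiplicity, so the lists are permutations of each
    other; being sorted, they coincide. *)
Lemma fact_type_degrees g h : g != 0 -> h != 0 -> fact_type g = fact_type h ->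
  [seq (size p).-1 | p <- irr_factor_seq g] =
  [seq (size p).-1 | p <- irr_factor_seq h].
Proof.
move=> g0 h0 ftE.
have sE : (size g).-1 = (size h).-1.
  by have := congr1 size ftE; rewrite !size_map !size_iota.
have sorted_degrees k : sorted leq [seq (size p).-1 | p <- irr_factor_seq k].
  by rewrite -sort_map; apply/sort_sorted/leq_total.
apply: (sorted_eq leq_trans anti_leq) => //.
apply/allP => i; rewrite mem_cat => i_deg /=.
have /andP[i_gt0 i_le] : (0 < i <= (size g).-1)%N.
  by case/orP: i_deg => /irr_factor_seq_size; rewrite ?sE; apply.
have i_lt : (i.-1 < (size g).-1)%N by rewrite prednK.
(* Degrees are counted from 1, so degree [i] sits at index [i.-1]. *)
have := congr1 (nth 0%N ^~ i.-1) ftE.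
rewrite !(nth_map 0%N) ?size_iota -?sE // !nth_iota // add1n prednK //.
by rewrite !count_irr_factor_seq => ->.
Qed.

Lemma radical_idem h : radical (radical h) = radical h.
Proof.
rewrite [LHS]radicalE [RHS]radicalE; apply: perm_big.
apply: uniq_perm; rewrite ?irr_factor_seq_uniq // => p.
apply/idP/idP => [/(mem_irr_factor_seq _ (radical_neq0 h))|p_h].
  by case=> mp irr_p; rewrite radicalE irredp_dvd_prod //;
    apply: irr_factor_seq_irreds.
have [mp irr_p] := irr_factor_seq_irreds p_h.
apply/(mem_irr_factor_seq _ (radical_neq0 h)); split=> //.
by rewrite radicalE irredp_dvd_prod //; apply: irr_factor_seq_irreds.
Qed.

(** * The norm and the residue ring *)

Lemma pabsM g h : g != 0 -> h != 0 -> pabs (g * h) = (pabs g * pabs h)%N.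
Proof.
move=> g0 h0; rewrite /pabs size_mul // -expnD; congr (_ ^ _)%N.
move: g0 h0; rewrite -!size_poly_gt0; move: (size g) (size h) => m n; lia.
Qed.

Lemma pabs_gt0 h : (0 < pabs h)%N.
Proof. by rewrite expn_gt0; apply/orP; left; apply/card_gt0P; exists 0. Qed.

Lemma pabs_prod ps : all (fun p => p != 0) ps ->
  pabs (\prod_(p <- ps) p) = foldr muln 1%N [seq pabs p | p <- ps].
Proof.
elim: ps => [|p ps IH] /=; first by rewrite big_nil /pabs size_poly1.
case/andP=> p0 ps0; rewrite big_cons pabsM ?IH //.
by rewrite prodf_seq_neq0.
Qed.

Lemma monicize_monic h : h != 0 -> monicize h \is monic.
Proof. by move=> h0; rewrite monicE lead_coefZ mulVf // lead_coef_eq0. Qed.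

Lemma eqp_monicize h : h != 0 -> monicize h %= h.
Proof. by move=> h0; rewrite eqp_scale // invr_eq0 lead_coef_eq0. Qed.

(** [mk_monic] replaces a modulus that is constant or not monic by ['X]; this default does not occur
    here. *)
Lemma size_modulus h : (1 < size h)%N -> size (mk_monic (monicize h)) = size h.
Proof.
move=> sh; have h0 : h != 0 by rewrite -size_poly_gt0 ltnW.
have sE := eqp_size (eqp_monicize h0).
by rewrite /mk_monic monicize_monic // andbT sE sh.
Qed.

Lemma size_residue h (a : {poly %/ monicize h}) :
  (1 < size h)%N -> (size a < size h)%N.
Proof. by move=> sh; rewrite -(size_modulus sh) size_mk_monic. Qed.

Lemma card_residue h : (1 < size h)%N -> #|{poly %/ monicize h}| = pabs h.
Proof. by move=> sh; rewrite card_qpoly size_modulus. Qed.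

Lemma eq_modp a b d : (a %% d == b %% d) = (d %| a - b).
Proof.
by rewrite -subr_eq0 -modpN -modpD; apply: (sameP eqP); apply: modp_eq0P.
Qed.

Lemma npolyp_modp_inj n d p q : d != 0 -> n = (size d).-1 ->
  npolyp n (p %% d) = npolyp n (q %% d) -> p %% d = q %% d.
Proof.
move=> d0 ->; have le_mod r : (size (r %% d)%R <= (size d).-1)%N.
  by rewrite -ltnS prednK ?ltn_modp // size_poly_gt0.
by move/(congr1 (@polyn _ _)); rewrite !npolypK.
Qed.

Lemma residue_inj h (a b : {poly %/ monicize h}) : (1 < size h)%N ->
  h %| polyn a - polyn b -> a = b.
Proof.
move=> sh /dvdp_leq; rewrite leqNgt => le_h; apply/val_inj/eqP => /=.
rewrite -subr_eq0; apply: contraT => /le_h; apply: contraNT => _.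
by rewrite (leq_ltn_trans (size_polyD _ _)) // size_polyN gtn_max !size_residue.
Qed.

(** * Adjacency as coprimality, and the isomorphisms *)

Lemma unitary_edgeE h (a b : gcd_graph h (pred1 1)) : (1 < size h)%N ->
  edge a b = coprimep (polyn a - polyn b) h.
Proof.
move=> sh; have h0 : h != 0 by rewrite -size_poly_gt0 ltnW.
rewrite gcd_graphE /gcd_adj !inE; last first.
  apply: contraTneq sh => h1.
  by rewrite -(eqp_size (eqp_monicize h0)) h1 size_poly1.
have gcd0 : gcdp (polyn a - polyn b) h != 0 by rewrite gcdp_eq0 (negPf h0) andbF.
rewrite -eqp_monic ?monicize_monic ?monic1 // -size_poly_eq1.
by rewrite (eqp_size (eqp_monicize gcd0)).
Qed.

(** If the gcd of [d] and [g * h] divides [g], a common divisor of [d] and [h] divides both [g] and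
    [h], so it is a unit. Conversely, if [d] is coprime to [h], that gcd is the gcd of [d] and
    [g]. *)
Lemma Div_edgeE g h (a b : gcd_graph (g * h) (Div g)) :
  (1 < size g)%N -> (1 < size h)%N -> coprimep g h ->
  edge a b = coprimep (polyn a - polyn b) h.
Proof.
move=> sg sh co_gh.
have g0 : g != 0 by rewrite -size_poly_gt0 ltnW.
have h0 : h != 0 by rewrite -size_poly_gt0 ltnW.
have gh0 : g * h != 0 by rewrite mulf_neq0.
rewrite gcd_graphE /gcd_adj !inE; last first.
  rewrite monicize_monic // (eqp_dvdl _ (eqp_monicize gh0)) -[X in _ %| X]mulr1.
  by rewrite dvdp_mul2l // dvdp1 neq_ltn sh orbT.
have gcd0 : gcdp (polyn a - polyn b) (g * h) != 0.
  by rewrite gcdp_eq0 (negPf gh0) andbF.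
rewrite monicize_monic // (eqp_dvdl _ (eqp_monicize gcd0)).
set d := _ - _ in gcd0 *; apply/idP/idP => [dvd_g|co_dh].
  apply/coprimepP => e ed eh; apply: (coprimepP _ _ co_gh) (eh).
  by apply: dvdp_trans dvd_g; rewrite dvdp_gcd ed dvdp_mull.
by rewrite (eqp_dvdl _ (Gauss_gcdpl _ co_dh)) dvdp_gcdr.
Qed.

(** Chinese remainder theorem, with surjectivity obtained by counting. The codomain mentions only
    the degrees [ds], so that different moduli with equal degrees share it. *)
Lemma unitary_graph_residues h ps : (1 < size h)%N ->
    monic_irreds ps -> uniq ps -> h = \prod_(p <- ps) p ->
    let ds := [seq (size p).-1 | p <- ps] in
  exists2 c : gcd_graph h (pred1 1) ->
              {dffun forall i : 'I_(size ds), {poly_(nth 0%N ds i) F}},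
    bijective c & forall a b, edge a b = [forall i, c a i != c b i].
Proof.
move=> sh irr_ps uniq_ps hE ds.
have size_ds : size ds = size ps by rewrite size_map.
have ps_i (i : 'I_(size ds)) : ps`_i \in ps by rewrite mem_nth // -size_ds.
have irr_i i : irreducible_poly ps`_(i : 'I_(size ds)).
  by have [] := irr_ps _ (ps_i i).
have all_ps (P : pred {poly F}) : all P ps = [forall i : 'I_(size ds), P ps`_i].
  apply/(all_nthP 0)/forallP => [P_ps i|P_ps i i_lt].
    by apply: P_ps; rewrite -size_ds.
  by rewrite -size_ds in i_lt; apply: (P_ps (Ordinal i_lt)).
pose c (a : gcd_graph h (pred1 1)) :
    {dffun forall i : 'I_(size ds), {poly_(nth 0%N ds i) F}} :=
  [ffun i : 'I_(size ds) => npolyp (nth 0%N ds i) (polyn a %% ps`_i)].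
have cE a b i : (c a i == c b i) = (ps`_i %| polyn a - polyn b).
  rewrite -eq_modp !ffunE; apply/eqP/eqP => [|-> //].
  apply: npolyp_modp_inj; first exact/irredp_neq0.
  by rewrite (nth_map 0) // -size_ds.
exists c => [|a b].
  apply: inj_card_bij => [a b cab|].
    apply: residue_inj => //; rewrite [X in X %| _]hE dvdp_prod_irreds // all_ps.
    by apply/forallP => i; rewrite -cE cab.
  (* Both cardinals are products of [q ^ deg p] over the factors, compared as folds over the same
     list. *)
  rewrite card_residue // [X in pabs X]hE pabs_prod; last first.
    by apply/allP => p /irr_ps[_ /irredp_neq0].
  rewrite card_dep_ffun; apply: eq_leq; congr foldr.
  rewrite /image_mem -[ps in RHS](mkseq_nth 0) /mkseq -size_ds.
  rewrite -val_enum_ord -!map_comp; apply: eq_map => i /=.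
  by rewrite card_npoly (nth_map 0) // -size_ds.
rewrite unitary_edgeE // [X in coprimep _ X]hE coprimep_prod all_ps.
apply: eq_forallb => i.
by rewrite coprimep_sym irreducible_poly_coprime // cE.
Qed.

Lemma unitary_radical_iso g h : (1 < size g)%N -> (1 < size h)%N ->
    fact_type (radical g) = fact_type (radical h) ->
  graph_iso (gcd_graph (radical g) (pred1 1)) (gcd_graph (radical h) (pred1 1)).
Proof.
move=> sg sh /(fact_type_degrees (radical_neq0 g) (radical_neq0 h)) degE.
have residues (k : {poly F}) (sk : (1 < size k)%N) :=
  unitary_graph_residues (size_radical_gt1 sk)
    (@irr_factor_seq_irreds (radical k)) (irr_factor_seq_uniq (radical k)).
have radE (k : {poly F}) :
    radical k = \prod_(p <- irr_factor_seq (radical k)) p.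
  by rewrite -radicalE radical_idem.
have [c [c' cK c'K] cE] := residues g sg (radE g).
(* The type of [c] depends on the degree list of [radical g]; generalizing [c] allows its
   replacement by that of [radical h]. *)
move: c c' cK c'K cE; rewrite degE => c c' cK c'K cE.
have [d [d' dK d'K] dE] := residues h sh (radE h).
exists (d' \o c) => [|a b].
  by exists (c' \o d); apply: can_comp.
by rewrite cE dE; apply: eq_forallb => i; rewrite /= !d'K.
Qed.

(* [(a %% r, a %/ r)] identifies the classes modulo [f] with pairs of a class
   modulo [r] and a polynomial of degree less than [deg f - deg r]. *)
Lemma gcd_graph_Div_wreath g h :
    (1 < size g)%N -> (1 < size h)%N -> coprimep g h ->
  graph_iso (gcd_graph (g * h) (Div g))
            (wreath (gcd_graph (radical h) (pred1 1))
                    (edgeless (pabs (g * h) %/ pabs (radical h)))).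
Proof.
move=> sg sh co_gh; set f := g * h; set r := radical h.
have g0 : g != 0 by rewrite -size_poly_gt0 ltnW.
have h0 : h != 0 by rewrite -size_poly_gt0 ltnW.
have f0 : f != 0 by rewrite mulf_neq0.
have sf : (1 < size f)%N.
  by rewrite (leq_trans sg) // dvdp_leq // dvdp_mulr.
have r0 : r != 0 := radical_neq0 h.
have sr : (1 < size r)%N := size_radical_gt1 sh.
have rf : r %| f by rewrite dvdp_mull // radical_dvd.
have fE : f = f %/ r * r by rewrite divpK.
have k0 : f %/ r != 0 by apply: contraNneq f0 => k0; rewrite fE k0 mul0r.
pose c (a : gcd_graph f (Div g)) : gcd_graph r (pred1 1) :=
  npolyp _ (polyn a %% r).
pose e (a : gcd_graph f (Div g)) : {poly_((size (f %/ r)%R).-1) F} :=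
  npolyp _ (polyn a %/ r).
have le_mod p : (size (p %% r)%R <= (size (mk_monic (monicize r))).-1)%N.
  by rewrite size_modulus // -ltnS prednK ?ltn_modp // ltnW.
have cE a : polyn (c a) = polyn a %% r by rewrite npolypK.
have eE a : polyn (e a) = polyn a %/ r.
  rewrite npolypK // !size_divp //.
  have := size_residue a sf; move: (size _) (size f) (size r) sr => x y z.
  lia.
have pfE : pabs f = (pabs (f %/ r) * pabs r)%N by rewrite {1}fE pabsM.
apply: (@wreath_edgeless_iso _ _ _ c e).
- by rewrite card_npoly pfE mulnK ?pabs_gt0.
- move=> a b [/(congr1 (@polyn _ _)) + /(congr1 (@polyn _ _))].
  rewrite !cE !eE => cab eab.
  by apply: val_inj; rewrite /= (divp_eq (polyn a) r) cab eab -divp_eq.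
- by rewrite /= !card_residue // pfE mulnK ?pabs_gt0 // mulnC.
move=> a b; rewrite Div_edgeE // unitary_edgeE // !cE.
rewrite -(coprimep_radical _ h0) -/r -modpN -modpD.
by rewrite ![coprimep _ r]coprimep_sym coprimep_modr.
Qed.

End FiniteField.

Theorem proposition5p9 (F : finFieldType) (f f1 f2 : {poly F})
    (f1_nonconst : (1 < size f1)%N) (f2_nonconst : (1 < size f2)%N)
    (f_def : f = f1 * f2) (f12_coprime : coprimep f1 f2)
    (same_type : fact_type (radical f1) = fact_type (radical f2)) :
  let G1 := gcd_graph f (Div f1) in
  let G2 := gcd_graph f (Div f2) in
  let W := wreath (gcd_graph (radical f1) (pred1 1))
                  (edgeless (pabs f %/ pabs (radical f1))) in
  [/\ graph_iso G1 G2, graph_iso G1 W & graph_iso G2 W].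
Proof.
move=> G1 G2 W.
(* The length of a factorization type is the degree, so both radicals give the same [m]. *)
have pabs_rad : pabs (radical f1) = pabs (radical f2).
  have := congr1 size same_type.
  by rewrite /pabs !size_map !size_iota => ->.
(* Adjacency for [Div f2] is governed by the complementary factor [f1], so [radical f1] appears
   directly. *)
have G2W : graph_iso G2 W.
  rewrite /G2 /W f_def mulrC; apply: gcd_graph_Div_wreath => //.
  by rewrite coprimep_sym.
have G1W : graph_iso G1 W.
  (* For [Div f1] the base graph is that of [radical f2], which has to be carried over to
     [radical f1]. *)
  have rad_iso := unitary_radical_iso f2_nonconst f1_nonconst (esym same_type).
  apply: graph_iso_trans (wreath_isol _ rad_iso).
  by rewrite pabs_rad /G1 f_def; apply: gcd_graph_Div_wreath.
by split=> //; apply: graph_iso_trans (graph_iso_sym G2W).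
Qed.
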